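(* Let $F$ be a scalar group, let $V$ be an $F$-space and let $S\subseteq V$. The following statements are equivalent. (1) $S$ is linearly independent; (2) $0\notin S$ and for any nonempty finite $A\subseteq S$ and $\alpha_a\in\operatorname{Span}(a)$ where $a\in A$, if $\sum_{a\in A}\alpha_a=0$, then $\alpha_a=0$ for all $a\in A$; (3) $0\notin S$ and $\operatorname{Span}(S)=\bigoplus_{s\in S}\operatorname{Span}(s)$; (4) $0\notin S$ and for every subset $T$ of $S$, $\operatorname{Span}(T)\cap\operatorname{Span}(S\setminus T)=\{0\}$; (5) $0\notin S$ and for every $s\in S$, $\operatorname{Span}(s)\cap\operatorname{Span}(S\setminus\{s\})=\{0\}$; (6) $0\notin S$ and $\{\operatorname{Span}(s)\}_{s\in S}$ is additively independent.
   Context: A scalar group is a tuple $F=(F,\cdot,1,0,-1)$ where $(F,\cdot,1)$ is a monoid, $0,-1\in F$, $0\cdot\alpha=0=\alpha\cdot 0$ for all $\alpha\in F$, $\{1,-1\}$ is the solution set of the equation $x^2=1$ in $F$, and $(F\setminus\{0\},\cdot,1)$ is a group. An $F$-space is an abelian group $(V,+)$ with a map $F\times V\to V$, $(\alpha,v)\mapsto\alpha\cdot v$, such that for all $\alpha,\beta\in F$, $v,w\in V$: $\alpha\cdot(\beta\cdot v)=(\alpha\cdot\beta)\cdot v$, $1\cdot v=v$, $\alpha\cdot(v+w)=\alpha\cdot v+\alpha\cdot w$, $(-1)\cdot v=-v$, $0\cdot v=0$. $\operatorname{Span}(S)$ is the intersection of all nonempty subsets of $V$ that contain $S$ and are closed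 under addition and scalar multiplication (so $\operatorname{Span}(\emptyset)=\{0\}$); $\operatorname{Span}(v)=\operatorname{Span}(\{v\})$. A subset $S\subseteq V$ is linearly independent if $0\notin S$ and for any nonempty finite $A\subseteq S$, $n_a\in\mathbb N$ and $\alpha_{a,i}\in F$ ($a\in A$, $1\le i\le n_a$), if $\sum_{a\in A}\left(\sum_{i=1}^{n_a}\alpha_{a,i}\cdot a\right)=0$ then $\sum_{i=1}^{n_a}\alpha_{a,i}\cdot a=0$ for all $a\in A$. For a family $\{S_i\}_{i\in I}$ of subsets of $V$, $\sum_{i\in I}S_i=\{\sum_{j\in J}s_j\mid J\subseteq I \text{ finite}, s_j\in S_j\}$, where the empty sum is $0$. The sum is direct, written $\bigoplus_{i\in I}S_i$, and the family is called additively independent, if for every finite $J\subseteq I$ and $s_j,s_j'\in S_j$ ($j\in J$), $\sum_{j\in J}s_j=\sum_{j\in J}s_j'$ implies $s_j=s_j'$ for all $j\in J$. *)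

(* Defs.v *)
From HB Require Import structures.
From mathcomp Require Import all_boot all_order all_algebra.
From mathcomp Require Import all_classical.

Set Implicit Arguments.
Unset Strict Implicit.
Unset Printing Implicit Defensive.

Import GRing.Theory.

Local Open Scope classical_set_scope.
Local Open Scope ring_scope.

(* The last three axioms say that F \ {0} is a group with unit 1; they include
   1 <> 0, whereas -1 = 1 is allowed. *)
HB.mixin Record Monoid_isScalarGroup F of monoid.Monoid F := {
  sgzero : F;
  sgopp1 : F;
  sgmul0 : forall a : F, (sgzero * a)%g = sgzero;
  sgmulr0 : forall a : F, (a * sgzero)%g = sgzero;
  sgsqr1 : forall x : F, (x * x)%g = 1%g <-> x = 1%g \/ x = sgopp1;
  sgone_neq0 : (1%g : F) <> sgzero;
  sgmul_neq0 : forall a b : F,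
    a <> sgzero -> b <> sgzero -> (a * b)%g <> sgzero;
  sginv : forall a : F, a <> sgzero ->
    exists b : F, [/\ b <> sgzero, (a * b)%g = 1%g & (b * a)%g = 1%g]
}.

#[short(type="scalarGroupType")]
HB.structure Definition ScalarGroup :=
  {F of monoid.Monoid F & Monoid_isScalarGroup F}.

HB.mixin Record Zmodule_isFSpace (F : scalarGroupType) V of GRing.Zmodule V := {
  fscale : F -> V -> V;
  fscaleA : forall (a b : F) (v : V), fscale a (fscale b v) = fscale (a * b)%g v;
  fscale1 : forall v : V, fscale 1%g v = v;
  fscaleDr : forall (a : F) (v w : V),
    fscale a (v + w) = fscale a v + fscale a w;
  fscaleN1 : forall v : V, fscale sgopp1 v = - v;
  fscale0 : forall v : V, fscale sgzero v = 0
}.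

#[short(type="fspaceType")]
HB.structure Definition FSpace (F : scalarGroupType) :=
  {V of GRing.Zmodule V & Zmodule_isFSpace F V}.

Notation "a **: v" := (fscale a v) (at level 40) : ring_scope.

Section FSpaceNotions.
Variables (F : scalarGroupType) (V : fspaceType F).

Definition subspace (W : set V) : Prop :=
  [/\ W !=set0,
      forall v w, W v -> W w -> W (v + w) &
      forall (a : F) v, W v -> W (a **: v)].

Definition Span (S : set V) : set V := smallest subspace S.

(* The coefficients alpha a i are used for a in A and i < n a only.  Scalars of
   F cannot be added, so the inner sum does not reduce to a single term. *)
Definition linearly_independent (S : set V) : Prop :=
  ~ S 0 /\
  forall (A : set V) (n : V -> nat) (alpha : V -> nat -> F),
    A !=set0 -> finite_set A -> A `<=` S ->
    \sum_(a \in A) (\sum_(i < n a) alpha a i **: a) = 0 ->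
    forall a, A a -> \sum_(i < n a) alpha a i **: a = 0.

End FSpaceNotions.

(* Families of subsets are indexed by a set D of indices in I; members outside
   D play no role. *)
Section Families.
Variables (V : zmodType) (I : choiceType) (D : set I) (X : I -> set V).

Definition family_sum : set V :=
  [set v | exists (J : set I) (s : I -> V),
     [/\ finite_set J, J `<=` D, forall j, J j -> X j (s j) &
         v = \sum_(j \in J) s j]].

Definition additively_independent : Prop :=
  forall (J : set I) (s s' : I -> V),
    finite_set J -> J `<=` D ->
    (forall j, J j -> X j (s j)) -> (forall j, J j -> X j (s' j)) ->
    \sum_(j \in J) s j = \sum_(j \in J) s' j ->
    forall j, J j -> s j = s' j.

Definition is_direct_sum (W : set V) : Prop :=
  W = family_sum /\ additively_independent.

End Families.

(* Main.v *)
(** Every Span(s) is a subgroup, so additive independence of these spans reduces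
    to the uniqueness of the representation of 0.  Since Span(S) is the sum of
    the Span(s), a vector in Span(T) and in Span(S \ T) has two representations
    with disjoint supports; extended by 0 to the union of the supports they must
    agree, so they vanish.  Conversely, in a relation among vectors of the
    Span(s) each term is minus the sum of the others, and so lies in
    Span(s) and in Span(S \ s). *)
Require Import Defs.
From mathcomp Require Import all_boot all_order all_algebra.
From mathcomp Require Import all_classical.

Import GRing.Theory.

Local Open Scope classical_set_scope.
Local Open Scope ring_scope.

(** Additive independence compares two sums over one index set only; extension by 0 brings sums over
    different sets to a common one. *)
Lemma fsum_patch (V : nmodType) (I : choiceType) (J K : set I) (s : I -> V) :
  J `<=` K -> \sum_(j \in J) s j = \sum_(k \in K) patch (fun=> 0) J s k.
Proof.
move=> JK; transitivity (\sum_(j \in J) patch (fun=> 0) J s j).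
  by apply: eq_fsbigr => j jJ; rewrite /patch jJ.
by apply: fsbig_widen => // k [_ /= nJk]; rewrite /patch memNset.
Qed.

Section Span.
Set Implicit Arguments.
Unset Strict Implicit.
Variables (F : scalarGroupType) (V : fspaceType F).
Implicit Types (S T W : set V) (a : F) (v : V).

Lemma fscaler0 a : a **: (0 : V) = 0.
Proof. by apply: (@addrI _ (a **: 0)); rewrite -fscaleDr !addr0. Qed.

Lemma fscale_sumr (I : Type) (r : seq I) (P : pred I) (f : I -> V) a :
  a **: (\sum_(i <- r | P i) f i) = \sum_(i <- r | P i) a **: f i.
Proof. by apply: (big_morph (fscale a)); [exact: fscaleDr|exact: fscaler0]. Qed.

Lemma fscale_fsumr (I : choiceType) (A : set I) (f : I -> V) a :
  finite_set A ->
  a **: (\sum_(i \in A) f i) = \sum_(i \in A) a **: f i.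
Proof. by move=> finA; rewrite !fsbig_finite// fscale_sumr. Qed.

Lemma subspace0 W : subspace W -> W 0.
Proof. by move=> [[v Wv] _ /(_ sgzero _ Wv)]; rewrite fscale0. Qed.

Lemma subspaceN W v : subspace W -> W v -> W (- v).
Proof. by move=> [_ _ WZ] Wv; rewrite -(@fscaleN1 F); exact: WZ. Qed.

Lemma subspaceB W v w : subspace W -> W v -> W w -> W (v - w).
Proof.
move=> subW Wv Ww; have [_ WD _] := subW.
by apply: WD => //; exact: subspaceN.
Qed.

Lemma subspace_sum W (I : Type) (r : seq I) (P : pred I) (f : I -> V) :
  subspace W -> (forall i, P i -> W (f i)) -> W (\sum_(i <- r | P i) f i).
Proof.
move=> subW Wf; have [_ WD _] := subW.
by apply: big_ind => //; exact: subspace0.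
Qed.

Lemma subspace_fsum W (I : choiceType) (A : set I) (f : I -> V) :
  subspace W -> finite_set A -> (forall i, A i -> W (f i)) ->
  W (\sum_(i \in A) f i).
Proof.
move=> subW finA Wf; rewrite fsbig_finite// big_seq.
by apply: subspace_sum => // i; rewrite in_fset_set// inE; exact: Wf.
Qed.

Lemma subspace_Span S : subspace (Span S).
Proof.
split=> [|v w Sv Sw W [subW SW]|a v Sv W [subW SW]].
- by exists 0 => W [subW _]; exact: subspace0.
- by have [_ WD _] := subW; apply: WD; [exact: Sv|exact: Sw].
- by have [_ _ WZ] := subW; apply: WZ; exact: Sv.
Qed.

Lemma sub_Span S : S `<=` Span S.
Proof. exact: sub_smallest. Qed.

Lemma Span_sub S W : subspace W -> S `<=` W -> Span S `<=` W.
Proof. exact: smallest_sub. Qed.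

Lemma SpanS S T : S `<=` T -> Span S `<=` Span T.
Proof.
move=> ST; apply: Span_sub; first exact: subspace_Span.
exact: subset_trans ST (@sub_Span T).
Qed.

(** Scalars cannot be added, so the multiples of [v] alone need not be closed under addition; their
    finite sums are. These are the inner sums of [linearly_independent], which links that notion to
    spans. *)
Lemma Span_set1P v w :
  Span [set v] w <-> exists n (alpha : nat -> F),
    w = \sum_(i < n) alpha i **: v.
Proof.
pose W := [set w | exists n (alpha : nat -> F), w = \sum_(i < n) alpha i **: v].
split=> [|[n [alpha ->]]]; last first.
  have subSv := @subspace_Span [set v]; have [_ _ SvZ] := subSv.
  refine (subspace_sum _ (P := xpredT) subSv _) => i _.
  by apply: SvZ; exact: sub_Span.
apply: (@Span_sub _ W); last first.
  by move=> _ ->; exists 1, (fun=> 1%g); rewrite big_ord1 fscale1.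
split=> [|_ _ [n [alpha ->]] [m [beta ->]]|a _ [n [alpha ->]]].
(* The zero vector is the sum of length 0, with dummy coefficients. *)
- by exists 0, 0, (fun=> 1%g); rewrite big_ord0.
(* Addition concatenates the coefficient lists, so [beta] starts at index [n]. *)
- exists (n + m)%N, (fun i => if (i < n)%N then alpha i else beta (i - n)%N).
  rewrite big_split_ord/=; congr (_ + _); apply: eq_bigr => i _.
    by rewrite ltn_ord.
  by rewrite ltnNge leq_addr/= addKn.
- exists n, (fun i => a * alpha i)%g; rewrite fscale_sumr.
  by apply: eq_bigr => i _; rewrite fscaleA.
Qed.

(** Sums over [J] and [K] are extended by 0 to the union and added termwise, as each member contains
    0 and is closed under addition. *)
Lemma family_sum_subspace (I : choiceType) (D : set I) (X : I -> set V) :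
  (forall i, D i -> subspace (X i)) -> subspace (family_sum D X).
Proof.
move=> subX; split=> [|_ _ [J [s [finJ JD Xs ->]]] [K [t [finK KD Xt ->]]]|].
- by exists 0, set0, (fun=> 0); split=> //; rewrite fsbig_set0.
- have JKD : J `|` K `<=` D by move=> i [/JD|/KD].
  exists (J `|` K), (fun i => patch (fun=> 0) J s i + patch (fun=> 0) K t i).
  split=> //; first by rewrite finite_setU.
    move=> i /JKD /subX subXi; have [_ XD _] := subXi.
    by apply: XD; rewrite /patch; case: ifPn => [/set_mem|_];
      [exact: Xs|exact: subspace0|exact: Xt|exact: subspace0].
  rewrite fsbig_split ?finite_setU//.
  by congr (_ + _); apply: fsum_patch => i; [left|right].
- move=> a _ [J [s [finJ JD Xs ->]]]; exists J, (fun i => a **: s i).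
  split=> //; last by rewrite fscale_fsumr.
  by move=> j Jj; have [_ _ XZ] := subX _ (JD _ Jj); exact/XZ/Xs.
Qed.

(** The one-term sums give a subspace containing [S]; conversely all terms of a sum lie in [Span S].
    Hence only directness remains to be shown in the third statement. *)
Lemma Span_family_sum S : Span S = family_sum S (fun s => Span [set s]).
Proof.
apply/seteqP; split.
  apply: Span_sub => [|v Sv].
    by apply: family_sum_subspace => s _; exact: subspace_Span.
  exists [set v], id; split=> //; first by move=> _ ->.
    by move=> _ ->; exact: sub_Span.
  by rewrite fsbig_set1.
move=> _ [J [s [finJ JS Ss ->]]].
apply: subspace_fsum => [|//|j Jj]; first exact: subspace_Span.
by apply: SpanS (Ss _ Jj) => _ ->; exact: JS.
Qed.

End Span.

Theorem lemma2p9 (F : scalarGroupType) (V : fspaceType F) (S : set V) :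
  [<->
    linearly_independent S;
    ~ S 0 /\
      (forall (A : set V) (alpha : V -> V),
        A !=set0 -> finite_set A -> A `<=` S ->
        (forall a, A a -> Span [set a] (alpha a)) ->
        \sum_(a \in A) alpha a = 0 ->
        forall a, A a -> alpha a = 0);
    ~ S 0 /\ is_direct_sum S (fun s => Span [set s]) (Span S);
    ~ S 0 /\
      (forall T : set V, T `<=` S -> Span T `&` Span (S `\` T) = [set 0]);
    ~ S 0 /\
      (forall s : V, S s -> Span [set s] `&` Span (S `\ s) = [set 0]);
    ~ S 0 /\ additively_independent S (fun s => Span [set s])
  ].
Proof.
have subSp (T : set V) : subspace (Span T) := subspace_Span T.
tfae=> -[S0 H]; split=> //.
- move=> A f A0 finA AS Af sumf0 a Aa.
  (* Choice selects a length and coefficients representing [f v] for each [v] in [A], and a default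
     pair elsewhere. *)
  have /choice[p fE] (v : V) : exists p : nat * (nat -> F),
      A v -> f v = \sum_(i < p.1) p.2 i **: v.
    have [/Af /Span_set1P[n [alpha ->]]|nAv] := pselect (A v).
      by exists (n, alpha).
    by exists (0, fun=> 1%g).
  rewrite fE//.
  apply: (H A (fun v => (p v).1) (fun v => (p v).2)) => //.
  by rewrite -[RHS]sumf0; apply: eq_fsbigr => v /set_mem Av; rewrite fE.
- split=> [|J s t finJ JS Js Jt st j Jj]; first exact: Span_family_sum.
  apply/eqP; rewrite -subr_eq0; apply/eqP.
  (* The differences of the two representations sum to 0, so the second statement applies to
     them. *)
  apply: (H J (fun j => s j - t j)) => //; first by exists j.
    by move=> i Ji; apply: (subspaceB (subSp _)); [exact: Js|exact: Jt].
  (* Negation, written as the scalar -1, can be pulled out of the sum. *)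
  under eq_fsbigr do rewrite -fscaleN1.
  by rewrite fsbig_split//= -fscale_fsumr// fscaleN1 st subrr.
- move=> T TS; apply/seteqP; split=> [v []|_ ->]; last first.
    by split; exact: subspace0 (subSp _).
  rewrite !Span_family_sum.
  move=> [J [s [finJ JT Js ->]]] [K [t [finK KT Kt sumE]]].
  have JKS : J `|` K `<=` S by move=> i [/JT /TS|/KT[]].
  apply: fsbig1 => j Jj.
  (* At an index of [J], which lies in [T], the extension of [t] is 0 while that of [s] is [s j]. *)
  have nKj : ~ K j by move=> /KT[_]; apply; exact: JT.
  have := H.2 (J `|` K) (patch (fun=> 0) J s) (patch (fun=> 0) K t).
  have Jpatch X r : (forall j, X j -> Span [set j] (r j)) ->
      forall j, (J `|` K) j -> Span [set j] (patch (fun=> 0) X r j).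
    move=> Xr i _; rewrite /patch; case: ifPn => [/set_mem|_]; first exact: Xr.
    exact: subspace0 (subSp _).
  rewrite finite_setU -!fsum_patch; [|by move=> ?; right|by move=> ?; left].
  move=> /(_ (conj finJ finK) JKS (Jpatch _ _ Js) (Jpatch _ _ Kt) sumE j).
  by rewrite /patch mem_set// memNset//; apply; left.
(* The case where [T] is the singleton of [s]. *)
- by move=> s Ss; apply: H => _ ->.
- move=> J s t finJ JS Js Jt st j Jj.
  have Jst i : J i -> Span [set i] (s i - t i).
    by move=> Ji; apply: (subspaceB (subSp _)); [exact: Js|exact: Jt].
  apply/eqP; rewrite -subr_eq0; apply/eqP.
  suff : (Span [set j] `&` Span (S `\ j)) (s j - t j) by rewrite H//; exact: JS.
  split; first exact: Jst.
  have finJj : finite_set (J `\ j) by exact: finite_setD.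
  (* The two sums over [J] agree, so the differences sum to 0 and the term at [j] can be
     isolated. *)
  have -> : s j - t j = - \sum_(i \in J `\ j) (s i - t i).
    under eq_fsbigr do rewrite -fscaleN1.
    rewrite fsbig_split//= -fscale_fsumr// fscaleN1 opprB.
    apply/eqP; rewrite subr_eq addrAC eq_sym subr_eq eq_sym; apply/eqP.
    have D1 (r : V -> V) : \sum_(i \in J) r i = r j + \sum_(i \in J `\ j) r i.
      exact: fsbigD1.
    by move: st; rewrite !D1 => ->; rewrite addrC.
  apply: (subspaceN (subSp _)).
  apply: (subspace_fsum (subSp _)) => // i [Ji ij].
  by apply: SpanS (Jst _ Ji) => _ ->; split=> //; exact: JS.
- move=> A n alpha A0 finA AS sum0 a Aa.
  (* The relation is compared with the zero family, which lies in every span. *)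
  apply: (H A (fun a => \sum_(i < n a) alpha a i **: a) (fun=> 0)) => //.
  + by move=> b Ab; apply/Span_set1P; exists (n b), (alpha b).
  + by move=> b _; exact: subspace0 (subSp _).
  + by rewrite sum0 fsbig1.
Qed.
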